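(* Let $p\in\mathcal P^{\log}(\mathbb R^n)$ with $p^+<\infty$. Then for every $m>0$ there exists $c>0$, depending only on $m$, $c_{\log}(p)$ and $p^+$ (and the fixed dimension $n$), such that $$\phi_a\Big(x,\frac1{|Q|}\int_Q|f|\,dy\Big)\le c\,\frac1{|Q|}\int_Q\phi_a(y,|f(y)|)\,dy+c\,|Q|^m$$ for every cube (or ball) $Q\subset\mathbb R^n$ with $\ell(Q)\le1$, all $x\in Q$, all $a\ge0$ and all $f\in L^1(Q)$ with $$a+\frac1{|Q|}\int_Q|f|\,dy\le\max\{1,|Q|^{-m}\}=|Q|^{-m}.$$
   Context: A variable exponent is a measurable function $p:\mathbb R^n\to[1,\infty]$; $p^+=\operatorname{ess\,sup}p$. $p\in\mathcal P^{\log}(\mathbb R^n)$ means that $1/p$ is log-Hölder continuous, i.e. there are $c\ge0$ and $\beta_\infty\in\mathbb R$ such that, with $\beta=1/p$, $|\beta(x)-\beta(y)|\le c/\log(e+1/|x-y|)$ and $|\beta(x)-\beta_\infty|\le c/\log(e+|x|)$ for all $x,y\in\mathbb R^n$. $c_{\log}(p)$ is the smallest such constant $c$. $|Q|$ is the Lebesgue measure of $Q$; $\ell(Q)$ is the side length of a cube $Q$ (the diameter if $Q$ is a ball). $\phi(x,t)=t^{p(x)}$ for $t\ge0$, and, with $'$ denoting the derivative in the second variable, the shifted function is $\phi_a(x,t)=\int_0^t\frac{\phi'(x,a+\tau)}{a+\tau}\tau\,d\tau$ for $a,t\ge0$. The right-hand side of the estimate may be $+\infty$. *)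

(* Defs.v *)
From HB Require Import structures.
From mathcomp Require Import all_boot all_order all_algebra.
From mathcomp Require Import all_classical all_reals all_analysis.
From mathcomp Require Import measurable_realfun ess_sup_inf.
Import Order.TTheory GRing.Theory Num.Theory.
Import numFieldNormedType.Exports.

Set Implicit Arguments.
Unset Strict Implicit.
Unset Printing Implicit Defensive.

Local Open Scope classical_set_scope.
Local Open Scope ring_scope.

(* The library has Lebesgue measure on the line only. On R^(n+1), written
   'rV[R]_n.+1 so that the dimension is at least 1, it is obtained here from the
   outer measure given by countable covers by half-open boxes, restricted to the
   Caratheodory-measurable sets (that is, the Lebesgue sigma-algebra). *)
Section lebesgue_outer_measure.
Variables (R : realType) (n : nat).
Implicit Types (a b : 'rV[R]_n.+1) (A : set 'rV[R]_n.+1).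

Definition box (ab : 'rV[R]_n.+1 * 'rV[R]_n.+1) : set 'rV[R]_n.+1 :=
  [set x | forall i, ab.1 ord0 i < x ord0 i <= ab.2 ord0 i].

(* The maximum gives volume 0 to the empty boxes. *)
Definition box_vol (ab : 'rV[R]_n.+1 * 'rV[R]_n.+1) : R :=
  \prod_(i < n.+1) Num.max 0 (ab.2 ord0 i - ab.1 ord0 i).

Definition box_cover A : set (nat -> 'rV[R]_n.+1 * 'rV[R]_n.+1) :=
  [set B | A `<=` \bigcup_k box (B k)].

Definition lebesgue_outer A : \bar R :=
  ereal_inf [set (\sum_(k <oo) (box_vol (B k))%:E)%E | B in box_cover A].

Lemma box_vol_ge0 ab : 0 <= box_vol ab.
Proof. by apply: prodr_ge0 => i _; rewrite le_max lexx. Qed.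

Local Open Scope ereal_scope.

Lemma lebesgue_outer_ge0 A : 0 <= lebesgue_outer A.
Proof.
apply: le_ereal_inf_tmp => _ [B AB <-].
by apply: nneseries_ge0 => k _ _; rewrite lee_fin box_vol_ge0.
Qed.

Lemma lebesgue_outer0 : lebesgue_outer set0 = 0.
Proof.
apply/eqP; rewrite eq_le lebesgue_outer_ge0 andbT.
apply: ereal_inf_lbound; exists (fun=> (0%R, 0%R)); first exact: sub0set.
apply: eseries0 => k _ _.
by rewrite /box_vol/= (bigD1 ord0)//= mxE subrr maxxx mul0r.
Qed.

Lemma le_lebesgue_outer : {homo lebesgue_outer : A B / A `<=` B >-> A <= B}.
Proof.
move=> A B AB; apply/ereal_inf_le_tmp => _ [C BC <-].
by exists C => //; exact: subset_trans AB BC.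
Qed.

Lemma lebesgue_outer_sigma_subadditive : sigma_subadditive lebesgue_outer.
Proof.
move=> A; have [[i ioo]|] := pselect (exists i, lebesgue_outer (A i) = +oo).
  rewrite (eseries_pinfty _ _ ioo) ?leey// => k _.
  by rewrite -ltNye (lt_le_trans _ (lebesgue_outer_ge0 _)).
rewrite -forallNE => Aoo.
suff add2e (e : {posnum R}) : lebesgue_outer (\bigcup_k A k) <=
    \sum_(i <oo) lebesgue_outer (A i) + e%:num%:E.
  by apply/lee_addgt0Pr => _/posnumP[].
rewrite (le_trans _ (epsilon_trick _ _ _))//; last first.
  by move=> k; exact: lebesgue_outer_ge0.
pose P k (B : nat -> 'rV[R]_n.+1 * 'rV[R]_n.+1) := box_cover (A k) B /\
  \sum_(j <oo) (box_vol (B j))%:E <=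
    lebesgue_outer (A k) + (e%:num / (2 ^ k.+1)%:R)%:E.
have [G PG] : {G & forall k, P k (G k)}.
  apply: (@choice _ _ P) => k; rewrite /P /lebesgue_outer.
  set S := (X in ereal_inf X); move infS : (ereal_inf S) => iS.
  case: iS infS => [r Sr|Soo|Soo].
  - have en1 : (0 < e%:num / (2 ^ k.+1)%:R)%R by [].
    have /(lb_ereal_inf_adherent en1) : ereal_inf S \is a fin_num by rewrite Sr.
    move=> [x [B AB muBx] xS].
    by exists B; split => //; rewrite muBx -Sr; exact/ltW.
  - by have := Aoo k; rewrite /lebesgue_outer Soo.
  - by have := lebesgue_outer_ge0 (A k); rewrite /lebesgue_outer Soo.
pose v (kj : nat * nat) := (box_vol (G kj.1 kj.2))%:E.
have v0 x : 0 <= v x by rewrite lee_fin box_vol_ge0.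
apply: (@le_trans _ _ (\esum_(i in setT) v i)).
  rewrite /lebesgue_outer; apply: ereal_inf_lbound => /=.
  have /card_esym/ppcard_eqP[f] := card_nat2.
  exists (fun k => G (f k).1 (f k).2).
    move=> t [i _ /((PG i).1)[j _ Gt]].
    by exists (f^-1%FUN (i, j)) => //=; rewrite invK ?inE.
  rewrite -[LHS]/(\sum_(k <oo) v (f k)).
  rewrite -(esum_pred_image v _ xpredT) ?[fun=> _]set_true//.
  by rewrite image_eq.
rewrite (_ : esum _ _ = \sum_(i <oo) \sum_(j <oo ) v (i, j)); last first.
  pose J : nat -> set (nat * nat) := fun i => [set (i, j) | j in setT].
  rewrite (_ : setT = \bigcup_k J k); last first.
    by rewrite predeqE => -[a b]; split => // _; exists a => //; exists b.
  rewrite esum_bigcupT /=; last 2 first.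
    - apply/trivIsetP => i j _ _ ij.
      rewrite predeqE => -[k m] /=; split => //= -[] [_] _ [<-{k} _].
      by move=> [m' _] [] /esym/eqP; rewrite (negbTE ij).
    - by move=> ?; exact: v0.
  rewrite -(image_id [set: nat]) -fun_true esum_pred_image//; last first.
    by move=> k _; exact: esum_ge0.
  apply: eq_eseriesr => /= j _.
  rewrite -(esum_pred_image v (pair j) predT)//=; last first.
    by move=> ? ? _ _; exact: (@can_inj _ _ _ snd).
  by congr esum; rewrite predeqE => -[a b]; split; move=> [i _ <-]; exists i.
apply: lee_nneseries => k _.
  by move=> _; apply: nneseries_ge0 => j _ _; exact: v0.
by move=> *; exact: (PG k).2.
Qed.

HB.instance Definition _ := isOuterMeasure.Build R 'rV[R]_n.+1 lebesgue_outer
  lebesgue_outer0 lebesgue_outer_ge0 le_lebesgue_outer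
  lebesgue_outer_sigma_subadditive.

End lebesgue_outer_measure.

Notation Rd R n := (caratheodory_type (@lebesgue_outer R n)).

Definition lebesgue_Rd (R : realType) (n : nat) : set (Rd R n) -> \bar R :=
  @lebesgue_outer R n.
Arguments lebesgue_Rd : clear implicits.

HB.instance Definition _ (R : realType) (n : nat) :=
  isMeasure.Build _ (Rd R n) R (@lebesgue_Rd R n)
    (@caratheodory_measure0 _ _ (@lebesgue_outer R n))
    (@caratheodory_measure_ge0 _ _ (@lebesgue_outer R n))
    (@caratheodory_measure_sigma_additive _ _ (@lebesgue_outer R n)).

Section variable_exponent.
Variables (R : realType) (n : nat).
Implicit Types (p : Rd R n -> \bar R) (Q : set (Rd R n)).

Local Notation mu := (lebesgue_Rd R n).

(* The library norm on 'rV[R]_n.+1 is the sup norm. *)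
Definition euclid (x : 'rV[R]_n.+1) : R :=
  Num.sqrt (\sum_(i < n.+1) x ord0 i ^+ 2).

(* Each face of a cube, and the boundary of a ball, may or may not belong to the
   set; the cubes have their faces parallel to the coordinate axes. *)
Definition cube_of_side Q (l : R) : Prop :=
  0 < l /\ exists (z : 'rV[R]_n.+1) (lo up : 'I_n.+1 -> bool),
    Q = [set x : 'rV[R]_n.+1 | forall i, x ord0 i \in
           Interval (BSide (lo i) (z ord0 i)) (BSide (up i) (z ord0 i + l))].

Definition ball_of_diameter Q (d : R) : Prop :=
  0 < d /\ exists (z : 'rV[R]_n.+1) (closed : bool),
    Q = [set x : 'rV[R]_n.+1 | euclid (x - z) < d / 2 ?<= if closed].

Definition average Q (g : Rd R n -> \bar R) : \bar R :=
  ((mu Q)^-1 * \int[mu]_(y in Q) g y)%E.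

Definition vol Q : R := fine (mu Q).

Definition variable_exponent p : Prop :=
  measurable_fun [set: Rd R n] p /\ forall x, (1 <= p x)%E.

(* The inverse in \bar R sends +oo to 0, and p >= 1, so the value is finite. *)
Definition inv_exponent p (x : Rd R n) : R := fine (p x)^-1%E.

Definition log_holder_const (beta : Rd R n -> R) (c : R) : Prop :=
  0 <= c /\ exists beta_oo : R,
    (forall x y : 'rV[R]_n.+1,
       `|beta x - beta y| <= c / ln (expR 1 + 1 / euclid (x - y))) /\
    (forall x : 'rV[R]_n.+1,
       `|beta x - beta_oo| <= c / ln (expR 1 + euclid x)).

Definition Plog p : Prop :=
  variable_exponent p /\ exists c, log_holder_const (inv_exponent p) c.

Definition clog p : R := inf [set c | log_holder_const (inv_exponent p) c].

Definition pplus p : \bar R := ess_sup mu p.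

(* Only used for p log-Hoelder with pplus p < +oo: then 1/p is continuous and
   bounded below by 1/p^+ almost everywhere, hence everywhere, so p is finite
   everywhere and the value of fine at +oo plays no role. *)
Definition phi p (x : Rd R n) (t : R) : R := t `^ fine (p x).

Definition shifted (psi : Rd R n -> R -> R) (a : R) (x : Rd R n) (t : R) :
    \bar R :=
  (\int[lebesgue_measure]_(tau in `[0%R, t])
     (derive1 (psi x) (a + tau)%R / (a + tau) * tau)%R%:E)%E.

End variable_exponent.

(* Main.v *)
Require Import Defs.
From mathcomp Require Import all_boot all_order all_algebra.
From mathcomp Require Import all_classical all_reals all_analysis.
From mathcomp Require Import measurable_realfun ess_sup_inf.
From mathcomp Require Import ring lra.
Import Order.TTheory GRing.Theory Num.Theory.
Import numFieldNormedType.Exports.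

Local Open Scope classical_set_scope.
Local Open Scope ring_scope.

(** For [phi(x, t) = t^(p x)] the integrand of the shifted function is
    [p x * slope a (p x) tau], where [slope a q s = (a + s)^(q - 1) * s / (a + s)]
    is a product of two nondecreasing functions of [s]. Hence
    [shifted (phi p) a x t] is comparable with [t * slope a (p x) t], with
    constants depending on [p^+] only ([shifted_le_slope], [slope_le_shifted]).

    Let [M] be the average of [|f|], let [q] be the infimum of [p] on [Q], and
    let [B = max 1 |Q|^(-m)]. Log-Hoelder continuity of [1/p] makes the
    oscillation of [p] on [Q] at most a constant over [ln (2 (n + 1) / l)], so
    [B^(p y - q) <= E] for [y] in [Q], with [E] depending on the data only
    ([inv_exponent_gap], [volume_power_le_expR]). The exponents [q] and [p y]
    are therefore interchangeable, at the cost of a factor [E], at every [s] with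
    [1 / B <= a + s <= B]. Above this range lowering the exponent to [q] costs
    nothing; below it, [s * slope a q s] is at most [1 / B <= |Q|^m]
    ([slope_exchange]).

    Jensen's inequality with constant exponent [q] is replaced by a cruder
    substitute for the tangent line: [slope a q M * (t - M / 2)] is nonpositive
    when [t <= M / 2], and otherwise monotonicity and doubling of the slope bound
    it by a multiple of [t / 2 * slope a q (t / 2)]. After the exchange of
    exponents this gives an affine minorant of
    [t |-> shifted (phi p) a y t], uniform in [y] ([slope_tangent]). Its average
    at [t = |f y|] is [slope a q M * M / 2] minus a multiple of [|Q|^m]
    ([average_ge_affine]), and the hypothesis [a + M <= B] lets [q] be replaced
    by [p x] on that side.

    Two facts about the Lebesgue measure built from box covers are
    needed: cubes and balls are measurable, and boxes have at least their
    elementary volume. The latter yields [|Q| >= (c l)^(n+1)], and also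
    [p <= p^+] at every point: this holds almost everywhere, hence on a dense
    set, and [1/p] is continuous ([exponent_le_pplus]). *)

Set Implicit Arguments.
Unset Strict Implicit.

(** * Monotonicity of the integral *)

(** The integral of a nonnegative function is a supremum over simple functions
    below it, so monotonicity requires no measurability. This matters because
    [y |-> shifted (phi p) a y |f y|] would otherwise have to be shown measurable. *)
Lemma le_integral_nonmeasurable (d : measure_display)
    (T : measurableType d) (R : realType) (mu : {measure set T -> \bar R})
    (D : set T) (f g : T -> \bar R) :
  (forall x, D x -> 0 <= g x)%E -> (forall x, D x -> f x <= g x)%E ->
  (\int[mu]_(x in D) f x <= \int[mu]_(x in D) g x)%E.
Proof.
move=> g0 fg; rewrite integralE.
apply: (@le_trans _ _ (\int[mu]_(x in D) (f ^\+ x)%E)%E).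
  by rewrite geeDl// oppe_le0 integral_ge0.
rewrite !ge0_integralE//; apply: ge_ereal_sup => _ [h /= hf <-].
apply: ereal_sup_ubound; exists h => //= x; apply: le_trans (hf x) _.
rewrite /patch; case: ifPn => // /set_mem Dx.
by rewrite funeposE ge_max fg// g0.
Qed.

(** * The slope of the shifted power function *)

Definition slope {R : realType} (a q s : R) : R :=
  (a + s) `^ (q - 1) * (s / (a + s)).

Lemma slope_ge0 (R : realType) (a q s : R) :
  0 <= a -> 0 <= s -> 0 <= slope a q s.
Proof. by move=> a0 s0; rewrite /slope mulr_ge0 ?powR_ge0 ?divr_ge0 ?addr_ge0. Qed.

(** Both [(a + s)^(q - 1)] and [s / (a + s)] are nondecreasing. *)
Lemma le_slope (R : realType) (a q s t : R) : 0 <= a -> 1 <= q ->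
  0 <= s -> s <= t -> slope a q s <= slope a q t.
Proof.
move=> a0 q1 s0 st; have [s00|sp] := leP s 0.
  have -> : s = 0 by lra.
  by rewrite /slope mul0r mulr0 slope_ge0 //; lra.
apply: ler_pM; rewrite ?powR_ge0 ?divr_ge0 ?addr_ge0//.
  by apply: ge0_ler_powR; rewrite ?nnegrE ?subr_ge0//; lra.
by rewrite ler_pdivlMr 1?mulrAC 1?ler_pdivrMr; nra.
Qed.

(** Doubling: halving [s] divides neither [a + s] nor [s] by more than 2, and
    does not increase the denominator [a + s] of the second factor. *)
Lemma slope_half (R : realType) (a q s : R) : 0 <= a -> 1 <= q -> 0 <= s ->
  slope a q s <= 2 `^ q * slope a q (s / 2).
Proof.
move=> a0 q1 s0; have [s00|sp] := leP s 0.
  have -> : s = 0 by lra.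
  by rewrite /slope !mul0r !mulr0.
rewrite /slope -[q in leRHS](subrK 1) [2 `^ _]powRD; last by rewrite pnatr_eq0 implybT.
rewrite powRr1// addrK -[X in _ <= X](_ : (2 * (a + s / 2)) `^ (q - 1) * (2 * (s / 2 / (a + s / 2))) = _); last first.
  by rewrite powRM; [ring|lra|lra].
apply: ler_pM; rewrite ?powR_ge0 ?divr_ge0 ?addr_ge0//.
  by apply: ge0_ler_powR; rewrite ?nnegrE ?subr_ge0//; lra.
by rewrite ler_pdivrMr ?mulrA 1?mulrAC 1?ler_pdivlMr; nra.
Qed.

Lemma slope_exponent (R : realType) (a q r s : R) : 0 < a + s ->
  slope a r s = (a + s) `^ (r - q) * slope a q s.
Proof.
move=> as0; rewrite /slope [RHS]mulrA -powRD; last by apply/implyP => _; rewrite gt_eqF.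
by congr (_ `^ _ * _); ring.
Qed.

(** At [a + t = 0], where the power function need not be differentiable, both
    sides vanish because of the factor [t]. *)
Lemma shifted_integrandE (R : realType) (a q t : R) : 0 <= a -> 0 <= t ->
  derive1 (fun s : R => s `^ q) (a + t) / (a + t) * t = q * slope a q t.
Proof.
move=> a0 t0; have [t00|tp] := leP t 0.
  have -> : t = 0 by lra.
  by rewrite /slope mul0r !mulr0.
rewrite powR_derive1 ?in_itv/= ?andbT; last lra.
by rewrite /slope; ring.
Qed.

Lemma shifted_le_slope (R : realType) (n : nat) (p : Rd R n -> \bar R)
    (x : Rd R n) (a t P : R) :
  0 <= a -> 0 <= t -> 1 <= fine (p x) -> fine (p x) <= P ->
  (shifted (phi p) a x t <= (P * (t * slope a (fine (p x)) t))%:E)%E.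
Proof.
rewrite /shifted /phi => a0 t0; move: (fine (p x)) => q p1 pP.
apply: (@le_trans _ _ (\int[lebesgue_measure]_(tau in `[0%R, t]) cst (q * slope a q t)%:E tau)%E).
  apply: le_integral_nonmeasurable => y /=; rewrite in_itv/= => /andP[y0 yt].
    rewrite lee_fin mulr_ge0 ?slope_ge0//; lra.
  rewrite lee_fin shifted_integrandE// ler_wpM2l ?le_slope//; lra.
rewrite integral_cst//= lebesgue_measure_itv/= lte_fin.
have S0 := @slope_ge0 R a q t a0 t0.
case: ifPn => [_|]; last by rewrite mule0 lee_fin => _; rewrite ?(mulr_ge0 _ (mulr_ge0 _ S0))//; lra.
rewrite -EFinB -EFinM lee_fin subr0.
have := mulr_ge0 t0 S0; nra.
Qed.

(** Only the upper half of the interval of integration is used. *)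
Lemma slope_le_shifted (R : realType) (n : nat) (p : Rd R n -> \bar R)
    (x : Rd R n) (a t : R) : 0 <= a -> 0 <= t -> 1 <= fine (p x) ->
  ((t / 2 * slope a (fine (p x)) (t / 2))%:E <= shifted (phi p) a x t)%E.
Proof.
rewrite /shifted /phi => a0 t0; move: (fine (p x)) => q p1.
have S0 : 0 <= slope a q (t / 2) by apply: slope_ge0 => //; lra.
apply: (@le_trans _ _ (\int[lebesgue_measure]_(tau in `[(t / 2)%R, t]) cst (slope a q (t / 2))%:E tau)%E).
  rewrite integral_cst//= lebesgue_measure_itv/= lte_fin.
  case: ifPn => [_|h]; last by rewrite mule0 lee_fin; nra.
  by rewrite -EFinB -EFinM lee_fin; nra.
rewrite [leLHS]integral_mkcond [leRHS]integral_mkcond.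
have integrand_ge0 y : `[0, t]%classic y ->
    0 <= derive1 (fun s => s `^ q) (a + y) / (a + y) * y.
  rewrite /= in_itv/= => /andP[y0 yt].
  rewrite shifted_integrandE// mulr_ge0 ?slope_ge0//; lra.
apply: le_integral_nonmeasurable => y _; rewrite /patch.
  by case: ifPn => // /set_mem yt; rewrite lee_fin integrand_ge0.
case: ifPn => [/set_mem/=|_]; last first.
  by case: ifPn => // /set_mem yt; rewrite lee_fin integrand_ge0.
rewrite in_itv/= => /andP[ty yt]; rewrite ifT; last first.
  by rewrite inE/= in_itv/=; apply/andP; split => //; lra.
rewrite lee_fin shifted_integrandE//; [|lra].
have := @le_slope R a q (t / 2) y a0 p1; have := @slope_ge0 R a q y a0.
nra.
Qed.

(** If [a + s >= 1 / B] then [(a + s)^(q - r) <= B^(r - q) <= E]. Otherwise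
    [a + s < 1 / B <= 1], and the left-hand side is at most [s < 1 / B]. *)
Lemma slope_exchange (R : realType) (a s q r B E : R) :
  0 <= a -> 0 < s -> 1 <= q -> q <= r -> 1 <= B -> B `^ (r - q) <= E ->
  s * slope a q s <= E * (s * slope a r s) + B^-1.
Proof.
move=> a0 s0 q1 qr B1 BE; have B0 : 0 < B by lra.
have u0 : 0 < a + s by lra.
have Er0 : 0 <= s * slope a r s by rewrite mulr_ge0 ?slope_ge0//; lra.
have E0 : 0 <= E by apply: le_trans BE; exact: powR_ge0.
have [uB|uB] := leP B^-1 (a + s).
  apply: (@le_trans _ _ (E * (s * slope a r s))); last by rewrite lerDl invr_ge0 (ltW B0).
  rewrite (slope_exponent r q)// mulrCA ler_wpM2r//.
  apply: le_trans BE; rewrite -(opprB r q) powRN -[leLHS]div1r.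
  rewrite ler_pdivrMr ?powR_gt0// -powRM ?(ltW B0) ?(ltW u0)//.
  rewrite -[leLHS](_ : 1 `^ (r - q) = 1); last by rewrite powR1.
  have Bu1 : 1 <= B * (a + s) by rewrite -ler_pdivrMl// mulr1.
  by rewrite ge0_ler_powR ?nnegrE ?subr_ge0//; lra.
have B11 : B^-1 <= 1 by rewrite invf_le1.
apply: (@le_trans _ _ B^-1); last by rewrite lerDr mulr_ge0.
have pow1 : (a + s) `^ (q - 1) <= 1.
  rewrite -[leRHS](_ : 1 `^ (q - 1) = 1); last by rewrite powR1.
  by rewrite ge0_ler_powR ?nnegrE ?subr_ge0//; lra.
have frac1 : s / (a + s) <= 1 by rewrite ler_pdivrMr// mul1r; lra.
have frac0 : 0 <= s / (a + s) by rewrite divr_ge0 ?(ltW s0) ?(ltW u0).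
apply: (@le_trans _ _ s); last lra.
rewrite ler_piMr ?(ltW s0)// /slope.
by rewrite mulr_ile1// powR_ge0.
Qed.

(** Substitute for convexity: for [t <= M / 2] the left-hand side is nonpositive,
    and for [t > M / 2] two halvings take [slope a q M] to
    [slope a q (M / 4) <= slope a q (t / 2)]. *)
Lemma slope_tangent (R : realType) (a M t q r B E P : R) :
  0 <= a -> 0 <= M -> 0 <= t -> 1 <= q -> q <= r -> q <= P ->
  1 <= B -> B `^ (r - q) <= E ->
  slope a q M * (t - M / 2) <=
    2 * 2 `^ P * 2 `^ P * (E * (t / 2 * slope a r (t / 2)) + B^-1).
Proof.
move=> a0 M0 t0 q1 qr qP B1 BE; set W := 2 `^ P.
have W0 : 0 <= W by exact: powR_ge0.
have qW : 2 `^ q <= W by apply: ler_powR => //; lra.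
have E0 : 0 <= E by apply: le_trans BE; exact: powR_ge0.
have [tM|Mt] := leP t (M / 2).
  apply: (@le_trans _ _ 0).
    by rewrite mulr_ge0_le0 ?slope_ge0//; lra.
  have t20 : 0 <= t / 2 by lra.
  apply: mulr_ge0; first by rewrite !mulr_ge0.
  by apply: addr_ge0; [exact/(mulr_ge0 E0)/(mulr_ge0 t20)/slope_ge0|rewrite invr_ge0; lra].
have t2 : 0 < t / 2 by lra.
have W20 : 0 <= 2 * W * W by rewrite !mulr_ge0.
have h1 : slope a q M <= W * (W * slope a q (t / 2)).
  apply: (le_trans (slope_half a0 q1 M0)).
  apply: ler_pM; rewrite ?powR_ge0 ?slope_ge0//; first lra.
  have M20 : 0 <= M / 2 by lra.
  apply: (le_trans (slope_half a0 q1 M20)).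
  apply: ler_pM; rewrite ?powR_ge0 ?slope_ge0 ?le_slope//; lra.
have h2 := slope_exchange a0 t2 q1 qr B1 BE.
have S0 : 0 <= slope a q M by exact: slope_ge0.
apply: (@le_trans _ _ (2 * W * W * (t / 2 * slope a q (t / 2)))); last first.
  by rewrite ler_wpM2l// !mulr_ge0.
rewrite [leRHS](_ : _ = W * (W * slope a q (t / 2)) * t); last by field.
apply: ler_pM => //; lra.
Qed.

(** * Lebesgue measure of boxes *)

Lemma integral_scaled_indic_ocitv (R : realType) (w a b : R) : 0 <= w ->
  (\int[lebesgue_measure]_t (w * \1_(`]a, b]) t)%:E
     = (w * Num.max 0 (b - a))%:E)%E.
Proof.
move=> w0; under eq_integral do rewrite EFinM.
rewrite ge0_integralZl_EFin//; last first.
  by apply/measurable_EFinP; exact: measurable_indic.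
rewrite integral_indic// setIT [X in (_ * X)%E](lebesgue_measure_itv `]a, b])/= lte_fin EFinM.
have [ab|ba] := ltP a b; first by rewrite max_r ?subr_ge0 ?ltW// EFinB.
by rewrite max_l// subr_le0.
Qed.

(** If the indicator of a [d]-dimensional box is dominated by a countable
    nonnegative combination of indicators of boxes, then so is its volume.
    Integrating the inequality in the last coordinate, on the line, trades that
    coordinate for a factor in the weights, which are there for this induction. *)
Lemma prod_length_le_cover (R : realType) (d : nat) (w : R) (v : nat -> R)
    (I : nat -> R * R) (J : nat -> nat -> R * R) :
  0 <= w -> (forall k, 0 <= v k) ->
  (forall x : nat -> R,
    (w * \prod_(i < d) \1_(`](I i).1, (I i).2]) (x i))%:E <=
    \sum_(k <oo) (v k * \prod_(i < d) \1_(`](J k i).1, (J k i).2]) (x i))%:E)%E ->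
  ((w * \prod_(i < d) Num.max 0 ((I i).2 - (I i).1))%:E <=
    \sum_(k <oo) (v k * \prod_(i < d) Num.max 0 ((J k i).2 - (J k i).1))%:E)%E.
Proof.
elim: d w v => [|d IH] w v w0 v0 H.
  have := H (fun=> 0); rewrite !big_ord0 => /le_trans; apply.
  by apply: lee_nneseries => k _; rewrite !big_ord0 // mulr1 lee_fin.
have M0 (c : R) : 0 <= Num.max 0 c by rewrite le_max lexx.
have P0 (K : nat -> R * R) (x : nat -> R) :
    0 <= \prod_(i < d) \1_(`](K i).1, (K i).2]) (x i) :> R.
  by apply: prodr_ge0 => i _; rewrite indicE ler0n.
(* Absorb the length of the last edge into the weights. *)
rewrite big_ord_recr/= [X in _ * X]mulrC mulrA.
under eq_eseriesr do rewrite big_ord_recr/= [X in _ * X]mulrC mulrA.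
apply: IH => [|k|x]; rewrite ?mulr_ge0//.
rewrite [X in X%:E]mulrAC -integral_scaled_indic_ocitv ?mulr_ge0//.
under eq_eseriesr => k _.
  rewrite [X in X%:E]mulrAC -integral_scaled_indic_ocitv ?mulr_ge0//.
  over.
rewrite -integral_nneseries//; last 2 first.
- move=> k; apply/measurable_EFinP; apply: measurable_funM => //.
- by move=> k t _; rewrite lee_fin !mulr_ge0// indicE ler0n.
apply: le_integral_nonmeasurable => t _.
  by apply: nneseries_ge0 => k _ _; rewrite lee_fin !mulr_ge0// indicE ler0n.
have := H (fun i => if i == d then t else x i).
rewrite big_ord_recr/= eqxx mulrA.
under [X in _ * X * _]eq_bigr => i _ do rewrite ltn_eqF//.
under [X in (_ <= X)%E -> _]eq_eseriesr => k _.
  rewrite big_ord_recr/= eqxx mulrA.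
  under [X in _ * X * _]eq_bigr => i _ do rewrite ltn_eqF//.
  over.
by [].
Qed.

Lemma box_vol_le_lebesgue_outer (R : realType) (n : nat)
    (ab : 'rV[R]_n.+1 * 'rV[R]_n.+1) :
  ((box_vol ab)%:E <= lebesgue_outer (box ab))%E.
Proof.
apply: le_ereal_inf_tmp => _ [B cov <-].
(* [inord] turns a natural number below [n.+1] into a coordinate. *)
pose edge (c : 'rV[R]_n.+1 * 'rV[R]_n.+1) (i : nat) :=
  (c.1 ord0 (inord i), c.2 ord0 (inord i)).
have volE c : box_vol c = 1 * \prod_(i < n.+1) Num.max 0 ((edge c i).2 - (edge c i).1).
  by rewrite mul1r; apply: eq_bigr => i _; rewrite /= inord_val.
rewrite volE; under eq_eseriesr do rewrite volE.
pose chi c (x : nat -> R) : R := \prod_(i < n.+1) \1_(`](edge c i).1, (edge c i).2]) (x i).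
have chi0 c x : 0 <= chi c x by apply: prodr_ge0 => i _; rewrite indicE ler0n.
have chi1 c (x : nat -> R) : box c (\row_i x i) -> chi c x = 1.
  move=> cx; apply: big1 => i _; rewrite indicE mem_set//=.
  by have := cx i; rewrite mxE inord_val in_itv.
apply: (@prod_length_le_cover R n.+1 1 (fun=> 1) (edge ab) (fun k => edge (B k))) => // x.
have [xab|/negP xab] := boolP `[<box ab (\row_i x i)>]; last first.
  rewrite (_ : \prod_(i < _) _ = 0).
    by rewrite mulr0; apply: nneseries_ge0 => k _ _; rewrite lee_fin mul1r; exact: chi0.
  have /existsNP[i xi] : ~ forall i : 'I_n.+1, ab.1 ord0 i < x i <= ab.2 ord0 i.
    by move=> h; apply: xab; apply/asboolP => i; rewrite mxE.
  rewrite (bigD1 i)//= indicE memNset ?mul0r//=.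
  by rewrite in_itv/= inord_val.
move/asboolP in xab; have [k _ kx] := cov _ xab.
apply: (@le_trans _ _ (\sum_(0 <= j < k.+1) (1 * chi (B j) x)%:E)%E); last first.
  by apply: nneseries_lim_ge => j _ _; rewrite lee_fin mul1r.
rewrite big_nat_recr//= [X in (X%:E <= _)%E](_ : _ = 1 * chi (B k) x); last first.
  by rewrite chi1//; congr (_ * _); exact: chi1.
apply: leeDr; apply: sume_ge0 => j _; by rewrite lee_fin mul1r.
Qed.

Lemma le_lebesgue_box_vol (R : realType) (n : nat)
    (ab : 'rV[R]_n.+1 * 'rV[R]_n.+1) :
  (lebesgue_outer (box ab) <= (box_vol ab)%:E)%E.
Proof.
(* Cover by the box itself and by empty boxes. *)
apply: ereal_inf_lbound; exists (fun k => if k == 0%N then ab else (0, 0)).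
  by move=> x abx; exists 0%N.
rewrite (nneseries_split _ 1) => [|k _]; last by rewrite lee_fin box_vol_ge0.
rewrite add0n big_nat1 eseries0 ?adde0// => -[//|k] _ _ /=.
by rewrite /box_vol (bigD1 ord0)//= !mxE subrr maxxx mul0r.
Qed.

(** * Measurability and geometry of cubes and balls *)

(** A half-space cuts each box of a cover into two boxes whose volumes add up
    to the original volume. *)
Lemma measurable_halfspace (R : realType) (n : nat) (i : 'I_n.+1) (r : R) :
  measurable ([set x : 'rV[R]_n.+1 | x ord0 i <= r] : set (Rd R n)).
Proof.
apply: le_caratheodory_measurable => X; apply: le_ereal_inf_tmp => _ [B cov <-].
pose lower (ab : 'rV[R]_n.+1 * 'rV[R]_n.+1) := (ab.1,
  \row_j (if j == i then Num.min (ab.2 ord0 i) r else ab.2 ord0 j)).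
pose upper (ab : 'rV[R]_n.+1 * 'rV[R]_n.+1) :=
  (\row_j (if j == i then Num.max (ab.1 ord0 i) r else ab.1 ord0 j), ab.2).
have split_vol ab : (box_vol (lower ab) + box_vol (upper ab) <= box_vol ab).
  rewrite /box_vol !(bigD1 (P := xpredT) i)//= !mxE eqxx.
  under eq_bigr => j ji do rewrite mxE (negbTE ji).
  under [X in _ + _ * X <= _]eq_bigr => j ji do rewrite mxE (negbTE ji).
  rewrite -mulrDl ler_wpM2r//.
    by apply: prodr_ge0 => j _; rewrite le_max lexx.
  by rewrite !maxEle !minEle; do ![case: ifPn => ?]; lra.
apply: (@le_trans _ _ (\sum_(k <oo) (box_vol (lower (B k)))%:E
                       + \sum_(k <oo) (box_vol (upper (B k)))%:E)%E).
  apply: leeD; apply: ereal_inf_lbound.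
    exists (fun k => lower (B k)) => // x [/cov[k _ kx] /= xi]; exists k => // j.
    rewrite /= mxE; case: eqP => [->|_]; last exact: kx.
    by rewrite le_min xi andbT; exact: kx.
  exists (fun k => upper (B k)) => // x [/cov[k _ kx] /= /negP]; rewrite -ltNge => xi.
  exists k => // j.
  rewrite /= mxE; case: eqP => [->|_]; last exact: kx.
  by rewrite gt_max xi andbT; exact: kx.
rewrite -nneseriesD => [|k _ _|k _ _]; rewrite ?lee_fin ?box_vol_ge0//.
by apply: lee_nneseries => k _; rewrite -?EFinD lee_fin ?addr_ge0 ?box_vol_ge0.
Qed.

Lemma measurable_coord (R : realType) (n : nat) (i : 'I_n.+1) :
  measurable_fun [set: Rd R n] (fun x : Rd R n => (x : 'rV[R]_n.+1) ord0 i).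
Proof.
apply: (measurability _ (RGenOInfty.measurableE R)) => _ [_ [r ->] <-].
rewrite setTI (_ : _ @^-1` _ = ~` [set x : 'rV[R]_n.+1 | x ord0 i <= r]).
  exact/measurableC/measurable_halfspace.
by apply/seteqP; split => x /=; rewrite in_itv/= andbT ltNge => /negP.
Qed.

Lemma measurable_euclid_sub (R : realType) (n : nat) (z : 'rV[R]_n.+1) :
  measurable_fun [set: Rd R n] (fun x : Rd R n => euclid ((x : 'rV[R]_n.+1) - z)).
Proof.
apply: (measurableT_comp (f := @Num.sqrt R)).
  by apply: continuous_measurable_fun; exact: sqrt_continuous.
apply: measurable_sum => i; apply: measurable_funX.
under eq_fun do rewrite !mxE.
by apply: measurable_funB => //; exact: measurable_coord.
Qed.

Lemma measurable_cube_of_side (R : realType) (n : nat) (Q : set (Rd R n)) (l : R) :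
  cube_of_side Q l -> measurable Q.
Proof.
move=> [_ [z [lo [up ->]]]].
rewrite (_ : [set _ | _] = \bigcap_(i in [set: 'I_n.+1])
   ((fun x : Rd R n => (x : 'rV[R]_n.+1) ord0 i) @^-1`
     [set` Interval (BSide (lo i) (z ord0 i)) (BSide (up i) (z ord0 i + l))])).
  apply: fin_bigcap_measurable => // i _.
  by rewrite -[X in measurable X]setTI; apply: measurable_coord.
by apply/seteqP; split => [x h i _|x h i]; [exact: h|exact: (h i)].
Qed.

Lemma measurable_ball_of_diameter (R : realType) (n : nat) (Q : set (Rd R n)) (d : R) :
  ball_of_diameter Q d -> measurable Q.
Proof.
move=> [_ [z [closed ->]]].
rewrite (_ : [set _ | _] = (fun x : Rd R n => euclid ((x : 'rV[R]_n.+1) - z)) @^-1`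
     [set` Interval -oo%O (BSide (~~ closed) (d / 2))]).
  by rewrite -[X in measurable X]setTI; apply: measurable_euclid_sub.
by apply/seteqP; split => x; case: closed; rewrite /= in_itv/=.
Qed.

Lemma ler_coord_euclid (R : realType) (n : nat) (v : 'rV[R]_n.+1) (i : 'I_n.+1) :
  `|v ord0 i| <= euclid v.
Proof.
rewrite -sqrtr_sqr ler_wsqrtr// (bigD1 i)//= lerDl.
by apply: sumr_ge0 => j _; exact: sqr_ge0.
Qed.

Lemma euclid_le_coord (R : realType) (n : nat) (v : 'rV[R]_n.+1) (r : R) :
  (forall i, `|v ord0 i| <= r) -> euclid v <= n.+1%:R * r.
Proof.
move=> vr; have r0 : 0 <= r by apply: le_trans (vr ord0).
have -> : n.+1%:R * r = Num.sqrt ((n.+1%:R * r) ^+ 2) :> R.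
  by rewrite sqrtr_sqr ger0_norm// mulr_ge0.
rewrite ler_wsqrtr//; apply: (@le_trans _ _ (\sum_(i < n.+1) r ^+ 2)).
  by apply: ler_sum => i _; rewrite -[leLHS]real_normK ?num_real// lerXn2r ?nnegrE.
rewrite sumr_const card_ord -[leLHS]mulr_natl exprMn ler_wpM2r ?sqr_ge0//.
by rewrite expr2 ler_peMl// ler1n.
Qed.

Lemma euclid_gt0 (R : realType) (n : nat) (v : 'rV[R]_n.+1) :
  v != 0 -> 0 < euclid v.
Proof.
move=> v0; rewrite lt0r sqrtr_ge0 andbT; apply: contra v0 => /eqP e0.
apply/eqP/rowP => i; rewrite mxE; apply/eqP.
by rewrite -normr_le0 -e0 ler_coord_euclid.
Qed.

Definition centered_box {R : realType} {n : nat} (z : 'rV[R]_n.+1) (s : R) :=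
  (z - const_mx (s / 2), z + const_mx (s / 2)).

Lemma box_vol_centered (R : realType) (n : nat) (z : 'rV[R]_n.+1) (s : R) :
  0 <= s -> box_vol (centered_box z s) = s ^+ n.+1.
Proof.
move=> s0; rewrite /box_vol (eq_bigr (fun=> s)) ?prodr_const ?card_ord// => i _.
by rewrite !mxE max_r; lra.
Qed.

Lemma centered_box_coord (R : realType) (n : nat) (z x : 'rV[R]_n.+1) (s : R) :
  box (centered_box z s) x -> forall i, `|x ord0 i - z ord0 i| <= s / 2.
Proof.
move=> zx i; have := zx i; rewrite /= !mxE => /andP[h1 h2].
by rewrite ler_norml; apply/andP; split; lra.
Qed.

(** Cubes and balls enter the proof only through these bounds on their
    extent. The inner box is not optimal: its side [l / (2 (n + 1))] is small
    enough to fit strictly inside both a cube of side [l] and a ball of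
    diameter [l]. *)
Lemma cube_or_ball_geometry (R : realType) (n : nat) (Q : set (Rd R n)) (l : R) :
  cube_of_side Q l \/ ball_of_diameter Q l ->
  0 < l /\ (forall x y : 'rV[R]_n.+1, Q x -> Q y ->
    forall i, `|x ord0 i - y ord0 i| <= l) /\
  exists z, box (centered_box z (l / (2 * n.+1%:R))) `<=` Q.
Proof.
have N1 : 1 <= n.+1%:R :> R by rewrite ler1n.
have N0 : 0 < n.+1%:R :> R by rewrite ltr0n.
(* A point of the inner box is within [l / 4] of the centre. *)
have sE (r : R) : n.+1%:R * (r / (2 * n.+1%:R) / 2) = r / 4 by field; rewrite gt_eqF.
move=> [[l0 [z [lo [up ->]]]]|[l0 [z [closed ->]]]]; split => //; split.
- move=> x y /= Qx Qy i; move: (Qx i) (Qy i); rewrite !itv_boundlr => /andP[x1 x2] /andP[y1 y2].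
  have {}x1 : z ord0 i <= x ord0 i by case: (lo i) x1 => //= /ltW.
  have {}y1 : z ord0 i <= y ord0 i by case: (lo i) y1 => //= /ltW.
  have {}x2 : x ord0 i <= z ord0 i + l by case: (up i) x2 => //= /ltW.
  have {}y2 : y ord0 i <= z ord0 i + l by case: (up i) y2 => //= /ltW.
  by rewrite ler_norml; apply/andP; split; lra.
- exists (z + const_mx (l / 2)) => x /centered_box_coord zx /= i.
  have {zx} := zx i; rewrite !mxE => xz.
  have : `|x ord0 i - (z ord0 i + l / 2)| <= l / 4.
    apply: le_trans xz _; rewrite -sE ler_peMl//.
    by rewrite divr_ge0 // divr_ge0 ?ltW// mulr_gt0.
  rewrite ler_norml => /andP[h1 h2].
  by case: (lo i); case: (up i); rewrite in_itv/=; apply/andP; split; lra.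
- move=> x y /= Qx Qy i.
  have half (w : 'rV[R]_n.+1) : (euclid (w - z) < l / 2 ?<= if closed) -> `|w ord0 i - z ord0 i| <= l / 2.
    move=> wz; have := ler_coord_euclid (w - z) i; rewrite !mxE => /le_trans; apply.
    by case: closed wz {Qx Qy} => //= /ltW.
  have := half _ Qx; have := half _ Qy; rewrite !ler_norml => /andP[? ?] /andP[? ?].
  by apply/andP; split; lra.
- exists z => x /centered_box_coord xz /=.
  have : euclid (x - z) <= l / 4.
    by rewrite -sE; apply: euclid_le_coord => i; rewrite !mxE.
  by case: closed => /= ?; lra.
Qed.

(** * Averages *)

(** Linearity of the average, for an affine minorant of a function [S] that
    need not be measurable. The value [M] comes first because the coefficients
    [al] and [be] are chosen in terms of it. *)
Lemma average_ge_affine (R : realType) (n : nat) (Q : set (Rd R n))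
    (f : Rd R n -> R) (S : Rd R n -> \bar R) (V : R) :
  measurable Q -> lebesgue_Rd R n Q = V%:E -> 0 < V ->
  (lebesgue_Rd R n).-integrable Q (EFin \o f) ->
  (forall y, Q y -> (0 <= S y)%E) ->
  exists2 M : R, 0 <= M & average Q (fun y => `|f y|%:E)%E = M%:E /\
    forall al be : R, (forall y, Q y -> ((al * `|f y| - be)%:E <= S y)%E) ->
      ((al * M - be)%:E <= average Q S)%E.
Proof.
move=> mQ QV V0 intf S0.
have intnf : (lebesgue_Rd R n).-integrable Q (EFin \o (fun y => `|f y|)).
  have -> : EFin \o (fun y => `|f y|) = (abse \o (EFin \o f)) by [].
  exact: integrable_abse.
have finf := integrable_fin_num mQ intnf.
set I := (\int[_]_(y in Q) _)%E in finf.
have I0 : (0 <= I)%E by apply: integral_ge0 => y _; rewrite lee_fin.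
exists (V^-1 * fine I).
  by rewrite mulr_ge0 ?invr_ge0 ?(ltW V0)// fine_ge0.
rewrite /average !QV inver gt_eqF//; split.
  by rewrite EFinM fineK.
move=> al be fS.
have : (\int[lebesgue_Rd R n]_(y in Q) (al * `|f y| - be)%:E
   <= \int[lebesgue_Rd R n]_(y in Q) S y)%E.
  exact: le_integral_nonmeasurable.
under eq_integral do rewrite EFinB EFinM.
rewrite integralB//; last 2 first.
- exact: integrableZl.
- apply/integrableP; split; first exact: measurable_cst.
  by rewrite integral_cst//= [X in (_ * X)%E]QV -EFinM ltry.
rewrite integralZl// -/I [X in (_ - X)%E](integral_cst _ mQ) [X in (_ - _ * X)%E]QV -(fineK finf).
rewrite -!EFinM -EFinB => le_IS.
rewrite -(_ : (V^-1%:E * (al * fine I - be * V)%:E)%E = (al * (V^-1 * fine I) - be)%:E).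
  by rewrite lee_wpmul2l// lee_fin invr_ge0 ltW.
by rewrite -EFinM; congr EFin; field; rewrite gt_eqF.
Qed.

(** * Log-Hoelder exponents *)

(** Approximating the infimum [clog p] by an admissible constant within 1 of it
    avoids proving that the infimum is attained. *)
Lemma clog_witness (R : realType) (n : nat) (p : Rd R n -> \bar R) (cl : R) :
  Plog p -> clog p = cl ->
  exists2 c, c <= cl + 1 & log_holder_const (inv_exponent p) c.
Proof.
move=> [_ [c0 hc0]] pcl.
have hinf : has_inf [set c | log_holder_const (inv_exponent p) c].
  by split; [exists c0|exists 0 => c []].
have [c hc cl1] := inf_adherent ltr01 hinf.
by exists c => //; rewrite -pcl ltW.
Qed.

Lemma ln_expR1D_ge1 (R : realType) (t : R) : 0 <= t -> 1 <= ln (expR 1 + t).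
Proof.
move=> t0; rewrite -{1}(expRK (R := R) 1) ler_ln ?posrE ?lerDl ?expR_gt0//.
by rewrite ltr_wpDr// expR_gt0.
Qed.

(** A null set contains no box. *)
Lemma exists_near_le_pplus (R : realType) (n : nat) (p : Rd R n -> \bar R)
    (y : 'rV[R]_n.+1) (eps : R) : 0 < eps ->
  exists2 x : 'rV[R]_n.+1, (p x <= pplus p)%E & euclid (x - y) <= eps.
Proof.
move=> eps0; apply: contrapT => far.
have [N [mN N0 sub]] := ess_sup_ge (lebesgue_Rd R n) p.
have N1 : 0 < n.+1%:R :> R by rewrite ltr0n.
pose s := 2 * eps / n.+1%:R.
have s0 : 0 < s by rewrite divr_gt0// mulr_gt0.
have boxN : box (centered_box y s) `<=` N.
  move=> x yx; apply: sub => /= px; apply: far; exists x => //.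
  rewrite (_ : eps = n.+1%:R * (s / 2)); last by rewrite /s; field; rewrite gt_eqF.
  by apply: euclid_le_coord => i; rewrite !mxE; exact: centered_box_coord.
have := box_vol_le_lebesgue_outer (centered_box y s).
rewrite box_vol_centered ?(ltW s0)// leNgt => /negP; apply.
apply: (@le_lt_trans _ _ 0%E); last by rewrite lte_fin exprn_gt0.
by rewrite -N0; exact: le_lebesgue_outer.
Qed.

(** The almost-everywhere bound holds on a dense set and extends to all points
    by continuity of [1/p]. In particular [p] is finite everywhere. *)
Lemma exponent_le_pplus (R : realType) (n : nat) (p : Rd R n -> \bar R)
    (c pp : R) :
  (forall x, (1 <= p x)%E) -> log_holder_const (inv_exponent p) c ->
  pplus p = pp%:E -> forall y, p y = (fine (p y))%:E /\ 1 <= fine (p y) <= pp.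
Proof.
move=> p1 [c0 [_ [hc _]]] ppE y.
have near_pp (x : Rd R n) : (p x <= pplus p)%E ->
    [/\ 1 <= pp & pp^-1 <= inv_exponent p x].
  rewrite ppE /inv_exponent; have := p1 x; case: (p x) => [r| |]//=.
  rewrite !lee_fin fine_invr => r1 rpp; split; first lra.
  by rewrite lef_pV2 ?posrE//; lra.
have [x0 /near_pp[pp1 _] _] := exists_near_le_pplus p (y : 'rV[R]_n.+1) ltr01.
have : pp^-1 <= inv_exponent p y.
  apply/ler_addgt0Pr => d d0.
  (* Within this distance the modulus of continuity is at most [d]. *)
  have [x /near_pp[_ xpp] xy] :=
    exists_near_le_pplus p (y : 'rV[R]_n.+1) (expR_gt0 (- (c / d))).
  suff : `|inv_exponent p x - inv_exponent p y| <= d by rewrite ler_norml => /andP[]; lra.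
  have [->|xney] := eqVneq (x : 'rV[R]_n.+1) y; first by rewrite subrr normr0 ltW.
  have D0 : 0 < euclid (x - y) by rewrite euclid_gt0// subr_eq0.
  apply: le_trans (hc x y) _.
  move: (euclid (x - y)) D0 xy => D D0 xy.
  have iD0 : 0 < 1 / D by rewrite divr_gt0.
  have L1 := ln_expR1D_ge1 (ltW iD0).
  have cdL : c / d <= ln (expR 1 + 1 / D).
    rewrite -[leLHS]expRK ler_ln ?posrE ?expR_gt0 ?addr_gt0 ?expR_gt0//.
    apply: (@le_trans _ _ (1 / D)); last by rewrite lerDr expR_ge0.
    by rewrite ler_pdivlMr// -ler_pdivlMl ?expR_gt0// mulr1 -expRN.
  by rewrite ler_pdivrMr; [rewrite mulrC -ler_pdivrMr|lra].
rewrite /inv_exponent; have := p1 y.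
case: (p y) => [r| |]//=.
  rewrite lee_fin fine_invr => r1 rpp; split => //; rewrite r1/=.
  by move: rpp; rewrite lef_pV2 ?posrE//; lra.
by move=> _; rewrite invr_le0; lra.
Qed.

(** With [D = |x - y| <= (n + 1) l], both [1] and [ln (1 / l)], up to a
    dimensional constant, are bounded by the logarithm [ln (e + 1 / D)] in the
    modulus of continuity. *)
Lemma inv_exponent_gap (R : realType) (n : nat) (beta : Rd R n -> R)
    (c l : R) (x y : 'rV[R]_n.+1) :
  log_holder_const beta c -> 0 < l -> euclid (x - y) <= n.+1%:R * l ->
  `|beta x - beta y| * ln (2 * n.+1%:R / l) <= c * (ln (2 * n.+1%:R ^+ 2) + 1).
Proof.
move=> [c0 [_ [hc _]]] l0 xyl.
have N1 : 1 <= n.+1%:R :> R by rewrite ler1n.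
move: (n.+1%:R : R) N1 xyl => N N1 xyl.
have N2 : 1 <= 2 * N ^+ 2 by nra.
have lnN := ln_ge0 N2.
(* At [x = y] the term [1 / D] is [1 / 0 = 0], so the modulus gives nothing. *)
have [->|xy] := eqVneq x y.
  by rewrite subrr normr0 mul0r mulr_ge0//; lra.
have D0 : 0 < euclid (x - y) by rewrite euclid_gt0// subr_eq0.
have hxy := hc x y.
move: (euclid (x - y)) D0 xyl hxy => D D0 xyl.
have iD0 : 0 < 1 / D by rewrite divr_gt0.
have L1 := ln_expR1D_ge1 (ltW iD0).
have e0 : 0 < expR 1 + 1 / D by rewrite addr_gt0 ?expR_gt0.
have lnT : ln (2 * N / l) <= ln (2 * N ^+ 2) + ln (expR 1 + 1 / D).
  rewrite -lnM ?posrE//; last lra.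
  rewrite ler_ln ?posrE ?divr_gt0 ?mulr_gt0//; try lra.
  apply: (@le_trans _ _ (2 * N ^+ 2 * (1 / D))).
    by rewrite ler_pdivrMr// mulrAC mulrA mulr1 ler_pdivlMr//; nra.
  by rewrite ler_wpM2l ?lerDr ?expR_ge0//; lra.
move: (ln (expR 1 + 1 / D)) L1 lnT => L L1 lnT hL.
move: (ln (2 * N ^+ 2)) lnN lnT => K K0 lnT.
apply: (@le_trans _ _ (c / L * ((K + 1) * L))).
  apply: (@le_trans _ _ (`|beta x - beta y| * ((K + 1) * L))).
    by rewrite ler_wpM2l//; nra.
  by rewrite ler_wpM2r//; nra.
by rewrite [leLHS](_ : _ = c * (K + 1))//; field; rewrite gt_eqF//; lra.
Qed.

(** Turns the modulus of continuity of [1/p] into one for the bounded exponent [p]. *)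
Lemma sub_le_sub_inv (R : realType) (r r' P : R) :
  1 <= r <= P -> 1 <= r' <= P -> r - r' <= P ^+ 2 * `|r^-1 - r'^-1|.
Proof.
move=> /andP[r1 rP] /andP[r'1 r'P].
have [r0 r'0] : r != 0 /\ r' != 0 by split; apply: lt0r_neq0; lra.
have -> : r - r' = r * r' * (r'^-1 - r^-1) by field; rewrite r0 r'0.
rewrite distrC; apply: (@le_trans _ _ (r * r' * `|r'^-1 - r^-1|)).
  by rewrite ler_wpM2l ?ler_norm// mulr_ge0//; lra.
by rewrite ler_wpM2r// expr2 ler_pM//; lra.
Qed.

(** A volume at least [(l / (2 (n + 1)))^(n + 1)] makes [|Q|^(-m)] at most
    [(2 (n + 1) / l)^((n + 1) m)], and raising this to a power [d] of order
    [1 / ln (2 (n + 1) / l)] leaves a bounded quantity. *)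
Lemma volume_power_le_expR (R : realType) (n : nat) (m V l d G : R) :
  0 < m -> 0 < l -> l <= 1 -> (l / (2 * n.+1%:R)) ^+ n.+1 <= V -> 0 <= d ->
  d * ln (2 * n.+1%:R / l) <= G ->
  Num.max 1 (V `^ (- m)) `^ d <= expR (m * n.+1%:R * G).
Proof.
move=> m0 l0 l1 lV d0 dG.
have N1 : 1 <= n.+1%:R :> R by rewrite ler1n.
set T := 2 * n.+1%:R / l in dG *.
have T1 : 1 <= T by rewrite ler_pdivlMr// mul1r; lra.
have T0 : 0 < T by lra.
have VT : V `^ (- m) <= T `^ (n.+1%:R * m).
  rewrite powRN powRrM powR_mulrn ?(ltW T0)// -[leRHS]invrK lef_pV2 ?posrE; last 2 first.
  - by rewrite powR_gt0//; apply: lt_le_trans lV; rewrite exprn_gt0// divr_gt0// mulr_gt0//; lra.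
  - by rewrite invr_gt0; exact/powR_gt0/exprn_gt0.
  rewrite -powRN -mulN1r powRrM powR_inv1 ?exprn_ge0 ?(ltW T0)//.
  have Ti : (T ^+ n.+1)^-1 <= V by rewrite -exprVn /T invf_div.
  rewrite ge0_ler_powR ?nnegrE ?(ltW m0) ?invr_ge0 ?exprn_ge0 ?(ltW T0)//.
  by apply: le_trans Ti; rewrite invr_ge0 exprn_ge0 ?(ltW T0).
apply: (@le_trans _ _ ((T `^ (n.+1%:R * m)) `^ d)).
  rewrite ge0_ler_powR ?nnegrE ?powR_ge0 ?le_max ?ler01// ge_max VT andbT.
  by rewrite -[leLHS](powRr0 T) ler_powR// mulr_ge0//; lra.
rewrite -powRrM /powR gt_eqF// ler_expR.
rewrite (_ : _ * ln T = m * n.+1%:R * (d * ln T)); last by ring.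
by rewrite ler_wpM2l// mulr_ge0//; lra.
Qed.

Lemma inverse_threshold_le (R : realType) (m V : R) : 0 < V ->
  (Num.max 1 (V `^ (- m)))^-1 <= V `^ m.
Proof.
move=> V0; have Vm : 0 < V `^ m by rewrite powR_gt0.
by rewrite -[leRHS]invrK lef_pV2 ?posrE ?invr_gt0 ?lt_max ?ltr01// -powRN le_max lexx orbT.
Qed.

(** * The estimate for averages of shifted functions *)

Unset Implicit Arguments.
Set Strict Implicit.

Theorem theorem2p4 (R : realType) (n : nat) (m cl pp : R) (m_gt0 : 0 < m) :
  exists2 c : R, 0 < c &
    forall p : Rd R n -> \bar R,
      Plog p -> clog p = cl -> pplus p = pp%:E ->
    forall (Q : set (Rd R n)) (l : R),
      cube_of_side Q l \/ ball_of_diameter Q l -> l <= 1 ->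
    forall x : Rd R n, Q x ->
    forall a : R, 0 <= a ->
    forall f : Rd R n -> R,
      (lebesgue_Rd R n).-integrable Q (EFin \o f) ->
      (a%:E + average Q (fun y => `|f y|%:E)
         <= (Num.max 1 (vol Q `^ (- m)))%:E)%E ->
      (shifted (phi p) a x (fine (average Q (fun y => `|f y|%:E)))
         <= c%:E * average Q (fun y => shifted (phi p) a y `|f y|)
            + (c * vol Q `^ m)%:E)%E.
Proof.
pose G := pp ^+ 2 * ((cl + 1) * (ln (2 * n.+1%:R ^+ 2) + 1)).
pose E := expR (m * n.+1%:R * G).
pose W : R := 2 `^ pp.
have W0 : 0 < W by exact: powR_gt0.
have E0 : 0 < E by exact: expR_gt0.
(* The absolute value and the summand 1 make the constant positive for all
   [cl] and [pp], even when no exponent [p] has these as its data. *)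
exists (1 + 4 * `|pp| * E * (W * W) * (E + 1)).
  by rewrite ltr_pwDl// !mulr_ge0// ?addr_ge0// ltW.
move=> p plog pcl ppE Q l Qgeo l1 x Qx a a0 f intf aM.
have [c ccl hc] := clog_witness plog pcl.
have pexp := exponent_le_pplus plog.1.2 hc ppE.
have mQ : measurable Q by case: Qgeo => [/measurable_cube_of_side|/measurable_ball_of_diameter].
have [l0 [Qdiam [z zQ]]] := cube_or_ball_geometry Qgeo.
have N1 : 1 <= n.+1%:R :> R by rewrite ler1n.
have s0 : 0 < l / (2 * n.+1%:R) by rewrite divr_gt0//; lra.
have [V QV lV] : exists2 V, lebesgue_Rd R n Q = V%:E &
    (l / (2 * n.+1%:R)) ^+ n.+1 <= V.
  have lQ : (((l / (2 * n.+1%:R)) ^+ n.+1)%:E <= lebesgue_Rd R n Q)%E.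
    rewrite -(box_vol_centered z) ?(ltW s0)//.
    exact: le_trans (box_vol_le_lebesgue_outer _) (le_lebesgue_outer zQ).
  (* [Q] has extent at most 1 and contains [x], hence it lies in a box of side 4. *)
  have QB : Q `<=` box (centered_box (x : 'rV[R]_n.+1) 4).
    move=> y Qy i; have := Qdiam y x Qy Qx i; rewrite !mxE ler_norml => /andP[? ?].
    by apply/andP; split; lra.
  have := le_trans (le_lebesgue_outer QB) (le_lebesgue_box_vol _).
  move: lQ; rewrite /lebesgue_Rd; case: (lebesgue_outer Q) => [V| |]//=.
  by rewrite lee_fin => lV _; exists V.
have V0 : 0 < V by apply: lt_le_trans lV; exact: exprn_gt0.
have volE : vol Q = V by rewrite /vol [X in fine X]QV.
rewrite volE in aM *.
set B := Num.max 1 (V `^ (- m)) in aM.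
have B1 : 1 <= B by rewrite le_max lexx.
have B0 : 0 < B by lra.
pose q := inf [set fine (p y) | y in Q].
pose T := 2 * n.+1%:R / l.
have T1 : 1 < T by rewrite ltr_pdivlMr// mul1r; lra.
have lnT : 0 < ln T by exact: ln_gt0.
have gap y y' : Q y -> Q y' -> (fine (p y) - fine (p y')) * ln T <= G.
  move=> Qy Qy'.
  have yy' : euclid ((y : 'rV[R]_n.+1) - y') <= n.+1%:R * l.
    by apply: euclid_le_coord => i; rewrite !mxE; exact: Qdiam.
  have := inv_exponent_gap hc l0 yy'; rewrite -/T /inv_exponent.
  have [-> /andP[r1 rpp]] := pexp y; have [-> /andP[r'1 r'pp]] := pexp y'.
  rewrite !fine_invr /= => gap.
  apply: (@le_trans _ _ (pp ^+ 2 * (`|(fine (p y))^-1 - (fine (p y'))^-1| * ln T))).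
    by rewrite mulrA ler_wpM2r ?(ltW lnT)// sub_le_sub_inv ?r1 ?r'1.
  rewrite ler_wpM2l ?sqr_ge0//; apply: le_trans gap _.
  rewrite ler_wpM2r// addr_ge0// ln_ge0//.
  by have := ler_pM ler01 ler01 N1 N1; rewrite -expr2; lra.
have q_lb : has_lbound [set fine (p y) | y in Q].
  by exists 1 => _ [y _ <-]; have [_ /andP[]] := pexp y.
have qp y : Q y -> q <= fine (p y).
  by move=> Qy; apply: ge_inf => //; exists y.
have q1 : 1 <= q.
  apply: lb_le_inf; first by exists (fine (p x)), x.
  by move=> _ [y _ <-]; have [_ /andP[]] := pexp y.
have BE y : Q y -> B `^ (fine (p y) - q) <= E.
  move=> Qy; apply: (volume_power_le_expR m_gt0 l0 l1 lV).
    by rewrite subr_ge0 qp.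
  rewrite -/T -ler_pdivlMr// lerBlDl -lerBlDr.
  apply: lb_le_inf; first by exists (fine (p x)), x.
  move=> _ [y' Qy' <-]; rewrite lerBlDr -lerBlDl ler_pdivlMr//.
  exact: gap.
have q_pp : q <= pp by apply: le_trans (qp x Qx) _; have [_ /andP[]] := pexp x.
have pp0 : 0 <= pp by lra.
set S := fun y => shifted (phi p) a y `|f y|.
have S0 y : Q y -> (0 <= S y)%E.
  move=> Qy; have [_ /andP[r1 _]] := pexp y.
  apply: le_trans (slope_le_shifted a0 (normr_ge0 (f y)) r1).
  by rewrite lee_fin mulr_ge0 ?slope_ge0 ?divr_ge0.
pose C := 2 * W * W * E.
have C0 : 0 < C by rewrite !mulr_gt0.
have [M M0 [ME avg_ge]] := average_ge_affine mQ QV V0 intf S0.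
rewrite ME /= in aM *; rewrite lee_fin in aM.
pose al := slope a q M / C.
pose be := slope a q M * (M / 2) / C + (E * B)^-1.
have tangent y : Q y -> ((al * `|f y| - be)%:E <= S y)%E.
  move=> Qy; have [_ /andP[r1 _]] := pexp y.
  apply: le_trans (slope_le_shifted a0 (normr_ge0 (f y)) r1).
  rewrite lee_fin.
  have := slope_tangent a0 M0 (normr_ge0 (f y)) q1 (qp y Qy) q_pp B1 (BE y Qy).
  move: (slope a (fine _) _) => h.
  rewrite -/W => tan.
  have -> : al * `|f y| - be = slope a q M * (`|f y| - M / 2) / C - (E * B)^-1.
    by rewrite /al /be; ring.
  rewrite lerBlDr ler_pdivrMr//; apply: le_trans tan _; rewrite le_eqVlt; apply/orP; left.
  by apply/eqP; rewrite /C; field; rewrite !gt_eqF.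
(* Raising the exponent from [q] to [p x] costs a factor [E], as [a + M <= B]. *)
have hx : slope a (fine (p x)) M <= E * slope a q M.
  have [M00|Mp] := leP M 0.
    have -> : M = 0 by lra.
    by rewrite /slope !mul0r !mulr0.
  have u0 : 0 < a + M by lra.
  rewrite (slope_exponent q _ u0) ler_wpM2r ?slope_ge0//.
  apply: le_trans (BE x Qx).
  by rewrite ge0_ler_powR ?nnegrE ?subr_ge0 ?qp//; lra.
have [_ /andP[px1 pxpp]] := pexp x.
apply: (le_trans (shifted_le_slope a0 M0 px1 pxpp)).
set c1 := 1 + _.
have c1_ge : 4 * pp * E * (W * W) * E <= c1 /\ 4 * pp * E * (W * W) <= c1.
  rewrite /c1 ger0_norm// mulrDr mulr1.
  have : 0 <= 4 * pp * E * (W * W) by rewrite !mulr_ge0 // ltW.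
  move=> h; have := mulr_ge0 h (ltW E0); split; lra.
have := avg_ge _ _ tangent.
have avg0 : (0 <= average Q S)%E.
  rewrite /average [X in (X^-1 * _)%E]QV inver gt_eqF// mule_ge0 ?lee_fin ?invr_ge0 ?(ltW V0)//.
  exact: integral_ge0.
have c10 : 0 < c1 by rewrite /c1 ltr_pwDl// !mulr_ge0// ?addr_ge0// ltW.
case: (average Q S) avg0 => [A| |]//; last first.
  by move=> _ _; rewrite gt0_muley ?lte_fin// addye// leey.
rewrite !lee_fin => A0.
rewrite /al /be => hA.
have BV := inverse_threshold_le m V0; rewrite -/B in BV.
have Bi0 : 0 < B^-1 by rewrite invr_gt0.
(* The tangent inequality integrates to the estimate for constant exponent [q]. *)
have {}hA : slope a q M * M <= 4 * (W * W) * (E * A + B^-1).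
  have {hA} : slope a q M / C * M <= A + (slope a q M * (M / 2) / C + (E * B)^-1) by lra.
  rewrite -(ler_pM2l (x := 2 * C)) ?mulr_gt0//.
  rewrite (_ : 2 * C * (A + _) = 2 * C * A + slope a q M * M + 2 * C * (E * B)^-1); last first.
    by field; rewrite !gt_eqF.
  rewrite (_ : 2 * C * (slope a q M / C * M) = 2 * (slope a q M * M)); last first.
    by field; rewrite !gt_eqF.
  rewrite (_ : 2 * C * (E * B)^-1 = 4 * (W * W) * B^-1); last first.
    by rewrite /C; field; rewrite !gt_eqF.
  rewrite /C; lra.
apply: (@le_trans _ _ (pp * (E * (4 * (W * W) * (E * A + V `^ m))))).
  rewrite ler_wpM2l//.
  apply: (@le_trans _ _ (M * (E * slope a q M))); first by rewrite ler_wpM2l.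
  rewrite mulrCA ler_wpM2l ?(ltW E0)// mulrC.
  apply: le_trans hA _; rewrite ler_wpM2l ?mulr_ge0 ?(ltW W0)//; lra.
have Vm0 : 0 <= V `^ m by exact: powR_ge0.
have h1 := ler_wpM2r A0 c1_ge.1.
have h2 := ler_wpM2r Vm0 c1_ge.2.
lra.
Qed.
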